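(* Let $\Sigma$ be an alphabet of size $q\ge2$ and $\mathbf{P}$ a Parikh vector with $\ell=\sum_i\mathbf{P}_i$. The $k$-centre problem for the language $\mathcal{L}^{\Sigma}_{\mathbf{P}}$ can be solved by an approximation algorithm with approximation factor $O\!\left(\frac{(k\cdot\ell)^{2/q}}{(\log_q(k\cdot q))^2}\right)$.
   Context: A necklace of length $\ell$ over $\Sigma=\{\sigma_1<\dots<\sigma_q\}$ is an equivalence class of words of $\Sigma^\ell$ under cyclic shift. $\mathcal{L}^{\Sigma}_{\mathbf{P}}$ is the set of necklaces in which $\sigma_i$ occurs exactly $\mathbf{P}_i$ times. Same-length representatives: for necklaces $\alpha,\beta$ of lengths $m,n$ with representatives $u,v$, take $a=u^{N/m}$, $b=v^{N/n}$, $N=\mathrm{lcm}(m,n)$. For a word $a$ of length $N$ read cyclically, $M(a)$ is the multiset consisting, for each length $l\in\{1,\dots,N\}$ and each start position $i$, of the cyclic factor of length $l$ starting at $i$, labelled by its number of occurrences among start positions $\le i$. Overlap coefficient $\mathfrak{C}(\alpha,\beta)=|M(a)\cap M(b)|/\min(|M(a)|,|M(b)|)$; overlap distance $\mathfrak{O}=\infty$ if $\mathfrak{C}=0$, $0$ if $\mathfrak{C}=1$, $1/\mathfrak{C}$ otherwise. $k$-centre problem on a finite language $\mathcal{L}$: choose $S\subseteq\mathcal{L}$ with $|S|=k$ minimising $\max_{v\in\mathcal{L}}\min_{s\in S}\mathfrak{O}(s,v)$; optimum $\mathfrak{D}_{\mathcal{L},k}$; approximation factor $f$ means output value $\le f\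cdot\mathfrak{D}_{\mathcal{L},k}$.
   Formalization: The constant hidden in O(.) may depend on the alphabet size q (not on P or k), since one constant for all q is impossible (P=(1,...,1), k about q^{q/2}); the algorithm is uniform in q and runs in time polynomial in q+ℓ+k, for ℓ≥1 and 1≤k≤|L|. *)

(* Defs.v *)
From HB Require Import structures.
From mathcomp Require Import all_boot all_order all_algebra.
From mathcomp Require Import finmap multiset.
From mathcomp Require Import reals constructive_ereal exp.

Set Implicit Arguments.
Unset Strict Implicit.
Unset Printing Implicit Defensive.

Import Order.TTheory GRing.Theory Num.Theory.

Local Open Scope nat_scope.

(* The alphabet is 'I_q; the letter i stands for sigma_{i+1}. *)

Definition necklace_of q l (w : l.-tuple 'I_q) : {set l.-tuple 'I_q} :=
  [set v : l.-tuple 'I_q | [exists i : 'I_l.+1, tval v == rot i w]].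

(* Some representative of the class; the overlap coefficient below does not
   depend on which one is picked. *)
Definition representative q l (alpha : {set l.-tuple 'I_q}) : seq 'I_q :=
  if [pick w in alpha] is Some w then tval w else [::].

Definition parikh_language q (P : q.-tuple nat) :
    {set {set (sumn P).-tuple 'I_q}} :=
  [set necklace_of w | w : (sumn P).-tuple 'I_q
                         & [forall i, count_mem i w == tnth P i]].

Definition wpow (T : Type) (u : seq T) (r : nat) : seq T :=
  flatten (nseq r u).

(* The length-l factor starting at position i (counted from 0), for
   i < size a and l <= size a. *)
Definition cyclic_factor (T : Type) (a : seq T) (l i : nat) : seq T :=
  take l (rot i a).

Definition occurrence_label (T : eqType) (a : seq T) (l i : nat) : nat :=
  count (fun j => cyclic_factor a l j == cyclic_factor a l i) (iota 0 i.+1).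

Definition labelled_factors (T : choiceType) (a : seq T) :
    {mset (seq T * nat)%type}%mset :=
  seq_mset [seq (cyclic_factor a l i, occurrence_label a l i)
           | l <- iota 1 (size a), i <- iota 0 (size a)].

Section Overlap.
Variables (R : realType) (q : nat).

Definition overlap_coefficient m n
    (alpha : {set m.-tuple 'I_q}) (beta : {set n.-tuple 'I_q}) : R :=
  let N := lcmn m n in
  let A := labelled_factors (wpow (representative alpha) (N %/ m)) in
  let B := labelled_factors (wpow (representative beta) (N %/ n)) in
  ((size (A `&` B)%mset)%:R / (minn (size A) (size B))%:R)%R.

Definition overlap_distance m n
    (alpha : {set m.-tuple 'I_q}) (beta : {set n.-tuple 'I_q}) : \bar R :=
  let c := overlap_coefficient alpha beta in
  if c == 0%R then +oo%E
  else if c == 1%R then 0%E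
  else (c^-1)%:E.

Definition centre_value l (L S : {set {set l.-tuple 'I_q}}) : \bar R :=
  \big[Order.max/-oo%E]_(v in L)
    \big[Order.min/+oo%E]_(s in S) overlap_distance s v.

Definition kcentre_optimum l (L : {set {set l.-tuple 'I_q}}) (k : nat) :
    \bar R :=
  \big[Order.min/+oo%E]_(S : {set {set l.-tuple 'I_q}}
                          | (S \subset L) && (#|S| == k))
    centre_value L S.

End Overlap.

Definition logb (R : realType) (b x : R) : R := (ln x / ln b)%R.

Definition approx_rate (R : realType) (q l k : nat) : R :=
  (((k * l)%:R `^ (2 / q%:R)) / (logb q%:R (k * q)%:R) ^+ 2)%R.

(* Model of computation: Jones' WHILE language on binary trees.  All tree
   operations and control steps have unit cost, except the equality test, which
   is charged the sizes of the compared trees.  Polynomial time in this model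
   is the usual polynomial time. *)

Inductive tree : Type := Nil | Cons of tree & tree.

Fixpoint tree_size (t : tree) : nat :=
  if t is Cons t1 t2 then (tree_size t1 + tree_size t2).+1 else 1.

Fixpoint tree_eqb (t u : tree) : bool :=
  match t, u with
  | Nil, Nil => true
  | Cons t1 t2, Cons u1 u2 => tree_eqb t1 u1 && tree_eqb t2 u2
  | _, _ => false
  end.

Definition tree_hd (t : tree) : tree := if t is Cons t1 _ then t1 else Nil.
Definition tree_tl (t : tree) : tree := if t is Cons _ t2 then t2 else Nil.

(* Nil is false, every other tree is true. *)
Definition tree_true (t : tree) : bool := if t is Nil then false else true.
Definition tree_of_bool (b : bool) : tree := if b then Cons Nil Nil else Nil.

Inductive expr : Type :=
  | EVar of nat
  | ENil
  | ECons of expr & expr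
  | EHd of expr
  | ETl of expr
  | EEq of expr & expr.

Inductive cmd : Type :=
  | Skip
  | Assign of nat & expr
  | Seq of cmd & cmd
  | If of expr & cmd & cmd
  | While of expr & cmd.

Definition store := nat -> tree.

Definition update (s : store) (x : nat) (t : tree) : store :=
  fun y => if y == x then t else s y.

Fixpoint eval (s : store) (e : expr) : tree :=
  match e with
  | EVar x => s x
  | ENil => Nil
  | ECons e1 e2 => Cons (eval s e1) (eval s e2)
  | EHd e1 => tree_hd (eval s e1)
  | ETl e1 => tree_tl (eval s e1)
  | EEq e1 e2 => tree_of_bool (tree_eqb (eval s e1) (eval s e2))
  end.

Fixpoint eval_cost (s : store) (e : expr) : nat :=
  match e with
  | EVar _ | ENil => 1
  | ECons e1 e2 => (eval_cost s e1 + eval_cost s e2).+1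
  | EHd e1 | ETl e1 => (eval_cost s e1).+1
  | EEq e1 e2 =>
      (eval_cost s e1 + eval_cost s e2
       + tree_size (eval s e1) + tree_size (eval s e2)).+1
  end.

(* exec c s s' t: started in store s, c halts in store s' after time t. *)
Inductive exec : cmd -> store -> store -> nat -> Prop :=
  | ExecSkip s : exec Skip s s 1
  | ExecAssign x e s :
      exec (Assign x e) s (update s x (eval s e)) (eval_cost s e).+1
  | ExecSeq c1 c2 s s1 s2 t1 t2 :
      exec c1 s s1 t1 -> exec c2 s1 s2 t2 ->
      exec (Seq c1 c2) s s2 (t1 + t2).+1
  | ExecIfTrue e c1 c2 s s1 t :
      tree_true (eval s e) -> exec c1 s s1 t ->
      exec (If e c1 c2) s s1 (eval_cost s e + t).+1
  | ExecIfFalse e c1 c2 s s1 t :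
      ~~ tree_true (eval s e) -> exec c2 s s1 t ->
      exec (If e c1 c2) s s1 (eval_cost s e + t).+1
  | ExecWhileFalse e c s :
      ~~ tree_true (eval s e) ->
      exec (While e c) s s (eval_cost s e).+1
  | ExecWhileTrue e c s s1 s2 t1 t2 :
      tree_true (eval s e) -> exec c s s1 t1 -> exec (While e c) s1 s2 t2 ->
      exec (While e c) s s2 (eval_cost s e + t1 + t2).+1.

(* Input and output are passed in variable 0; the others start as Nil. *)
Definition runs (p : cmd) (input output : tree) (t : nat) : Prop :=
  exists2 s, exec p (update (fun _ => Nil) 0 input) s t & s 0 = output.

Definition enc_seq (s : seq tree) : tree := foldr Cons Nil s.
Definition enc_nat (n : nat) : tree := enc_seq (nseq n Nil).
Definition enc_word q (w : seq 'I_q) : tree :=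
  enc_seq [seq enc_nat (nat_of_ord i) | i <- w].

(* An instance is (k, P), with all numbers in unary (any output has k * sum P
   letters); q is the number of entries of P. *)
Definition enc_instance q (P : q.-tuple nat) (k : nat) : tree :=
  Cons (enc_nat k) (enc_seq [seq enc_nat n | n <- P]).

(* A solution is written as a list of k words, one per centre. *)
Definition enc_solution q l k (ws : k.-tuple (l.-tuple 'I_q)) : tree :=
  enc_seq [seq enc_word (tval w) | w <- ws].

Definition centres q l k (ws : k.-tuple (l.-tuple 'I_q)) :
    {set {set l.-tuple 'I_q}} :=
  [set necklace_of w | w in tval ws].

(* Main.v *)
From mathcomp Require Import all_boot all_order all_algebra.
From mathcomp Require Import finmap multiset zify ring lra.
From mathcomp Require Import reals constructive_ereal sequences exp.
(* Last, so that [Nil] is the tree and not the abbreviation of [seq]. *)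
Require Import Defs.

(* Every set of k distinct necklaces of the language is a good enough solution,
   so the algorithm only has to find k of them.

   Let l be the length, let x and y be the two most frequent letters, occurring
   p1 >= p2 times, and let n be about log_2 (k l).  Two necklaces share the runs
   x^j, and since only O(q p2) letters differ from x these runs alone give a
   distance O(q^3 (p2 + 1)).  Conversely, k centres have at most k l < 2^n
   factors of length n, so some word B in {x, y}^n is a factor of none of them;
   a necklace consisting of about p2 / n evenly spread copies of B shares only
   factors of length O(n l / p2) with the centres, so the optimum is
   Omega((p2 + 1) / n).  The ratio O(q^3 n) is below the rate, because a power
   of k l beats the third power of its logarithm.

   The program is a depth-first search: rotating a word and swapping its first
   two letters generate all rearrangements, so the search cannot run out of
   candidates before it has met every necklace. *)

Set Implicit Arguments.
Unset Strict Implicit.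
Unset Printing Implicit Defensive.

Import Order.TTheory GRing.Theory Num.Theory.

Local Open Scope nat_scope.

Local Arguments update s x t y /.

(** * Timed total correctness of programs *)

Definition halts (c : cmd) (s : store) (Q : store -> nat -> Prop) : Prop :=
  exists s' t, exec c s s' t /\ Q s' t.

Fixpoint assigned (c : cmd) : seq nat :=
  match c with
  | Skip => [::]
  | Assign x _ => [:: x]
  | Seq c1 c2 | If _ c1 c2 => assigned c1 ++ assigned c2
  | While _ c1 => assigned c1
  end.

Definition agree_outside (xs : seq nat) (s s' : store) : Prop :=
  forall x, x \notin xs -> s' x = s x.

Lemma agree_outside_trans xs s1 s2 s3 :
  agree_outside xs s1 s2 -> agree_outside xs s2 s3 -> agree_outside xs s1 s3.
Proof. by move=> s12 s23 x xP; rewrite s23 ?s12. Qed.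

Lemma agree_outside_sub xs ys s s' :
  {subset xs <= ys} -> agree_outside xs s s' -> agree_outside ys s s'.
Proof. by move=> sub ss' x xP; apply: ss'; apply: contra xP; apply: sub. Qed.

Lemma agree_outside_update xs s x t :
  x \in xs -> agree_outside xs s (update s x t).
Proof.
by move=> xP y yP; rewrite /update; case: eqP yP => // ->; rewrite xP.
Qed.

Lemma exec_agree_outside c s s' t :
  exec c s s' t -> agree_outside (assigned c) s s'.
Proof.
elim=> {c s s' t} //=.
- by move=> x e s; apply: agree_outside_update; rewrite inE.
- move=> c1 c2 s s1 s2 t1 t2 _ fr1 _ fr2.
  by apply: agree_outside_trans (agree_outside_sub _ fr1)
    (agree_outside_sub _ fr2) => x; rewrite mem_cat => ->; rewrite ?orbT.
- move=> e c1 c2 s s1 t _ _; apply: agree_outside_sub => x.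
  by rewrite mem_cat => ->.
- move=> e c1 c2 s s1 t _ _; apply: agree_outside_sub => x.
  by rewrite mem_cat orbC => ->.
- by move=> e c s s1 s2 t1 t2 _ _ fr1 _; apply: agree_outside_trans.
Qed.

Section HaltingRules.
Implicit Types (c : cmd) (s : store) (Q : store -> nat -> Prop).

Lemma halts_frame c s Q Q' : halts c s Q ->
  (forall s' t, Q s' t -> agree_outside (assigned c) s s' -> Q' s' t) ->
  halts c s Q'.
Proof.
case=> s' [t [run Qs']] QQ'; exists s', t; split=> //.
exact: QQ' (exec_agree_outside run).
Qed.

Lemma halts_skip s Q : Q s 1 -> halts Skip s Q.
Proof. by exists s, 1; split=> //; apply: ExecSkip. Qed.

Lemma halts_assign x e s Q :
  Q (update s x (eval s e)) (eval_cost s e).+1 -> halts (Assign x e) s Q.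
Proof. by eexists _, _; split; [apply: ExecAssign|]. Qed.

Lemma halts_seq c1 c2 s Q :
  halts c1 s (fun s1 t1 => halts c2 s1 (fun s2 t2 => Q s2 (t1 + t2).+1)) ->
  halts (Seq c1 c2) s Q.
Proof.
case=> s1 [t1 [run1 [s2 [t2 [run2 Qs2]]]]].
by exists s2, (t1 + t2).+1; split=> //; apply: ExecSeq run1 run2.
Qed.

Lemma halts_if e c1 c2 s Q :
  halts (if tree_true (eval s e) then c1 else c2) s
    (fun s' t => Q s' (eval_cost s e + t).+1) ->
  halts (If e c1 c2) s Q.
Proof.
case=> s' [t [run Qs']]; exists s', (eval_cost s e + t).+1; split=> //.
by case: ifPn run => es; [apply: ExecIfTrue | apply: ExecIfFalse].
Qed.

Lemma halts_while (I : nat -> store -> Prop) x c T :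
  (forall n s, I n s -> tree_true (s x) ->
     halts c s (fun s' t => (exists2 m, m < n & I m s') /\ t <= T)) ->
  forall n s, I n s ->
  halts (While (EVar x) c) s (fun s' t =>
    [/\ exists m, I m s', ~~ tree_true (s' x) & t <= n * T.+2 + 2]).
Proof.
move=> body; elim/ltn_ind=> n IH s Is.
have [sx|sx] := boolP (tree_true (s x)); last first.
  exists s, 2; split; first exact: ExecWhileFalse.
  by split=> //; [exists n | rewrite leq_addl].
have [s1 [t1 [run1 [[m mn Im] t1T]]]] := body n s Is sx.
have [s2 [t2 [run2 [I2 s2x t2T]]]] := IH m mn s1 Im.
exists s2, (1 + t1 + t2).+1; split; first exact: ExecWhileTrue run1 run2.
split=> //; have : m.+1 * T.+2 <= n * T.+2 by rewrite leq_mul2r mn.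
by rewrite mulSn; lia.
Qed.

Definition foreach (x : nat) (c : cmd) : cmd :=
  While (EVar x) (Seq c (Assign x (ETl (EVar x)))).

Lemma halts_foreach (A : Type) (enc : A -> tree) (I : seq A -> store -> Prop)
    x c T s0 rs :
  x \notin assigned c -> s0 x = enc_seq (map enc rs) -> I rs s0 ->
  (forall r rs' s, agree_outside (x :: assigned c) s0 s ->
     s x = enc_seq (map enc (r :: rs')) -> I (r :: rs') s ->
     halts c s (fun s' t =>
       I rs' (update s' x (enc_seq (map enc rs'))) /\ t <= T)) ->
  halts (foreach x c) s0 (fun s t => I [::] s /\ t <= size rs * (T + 6) + 2).
Proof.
move=> xc s0x I0 body.
pose J n s := agree_outside (x :: assigned c) s0 s /\
  exists rs', [/\ n = size rs', s x = enc_seq (map enc rs') & I rs' s].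
have [| |s [t [run [[n [_ [rs' [_ sx Is]]]] nsx tT]]]] :=
    @halts_while J x (Seq c (Assign x (ETl (EVar x)))) (T + 4) _ (size rs) s0.
- move=> n s [fr [[|r rs'] [-> sx Is]]]; first by rewrite sx.
  move=> _; apply/halts_seq/(halts_frame (body r rs' s fr sx Is)).
  move=> s' t [Is' tT] fr'; apply: halts_assign; split; last by rewrite /=; lia.
  exists (size rs') => //; rewrite /= fr' //= sx; split; last first.
    by exists rs'; split; rewrite //= eqxx.
  apply: agree_outside_trans (agree_outside_update _ _ (mem_head _ _)).
  apply: agree_outside_trans fr (agree_outside_sub _ fr') => y yc.
  by rewrite inE yc orbT.
- by split=> //; exists rs.
exists s, t; split=> //; case: rs' sx nsx Is => [|r rs'] -> //= _ Is.
by split=> //; rewrite addnC in tT *; lia.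
Qed.

End HaltingRules.

(** * The search program *)

(* Registers; the input is read from register [output]. *)
Definition output : nat := 0.
Definition remaining : nat := 1.
Definition counts : nat := 2.
Definition tally : nat := 3.
Definition letter : nat := 4.
Definition word : nat := 5.
Definition stack : nat := 6.
Definition visited : nat := 7.
Definition todo : nat := 8.
Definition found : nat := 9.
Definition front : nat := 10.
Definition back : nat := 11.

Local Coercion EVar : nat >-> expr.
Local Notation "x <~ e" := (Assign x e) (at level 60).
Local Notation "c1 ;; c2" := (Seq c1 c2) (at level 65, right associativity).

Definition reverse_onto (x y : nat) : cmd := foreach x (y <~ ECons (EHd x) y).

Definition rotate_word : cmd :=
  front <~ ETl word ;;
  back <~ ENil ;;
  word <~ ECons (EHd word) ENil ;;
  reverse_onto front back ;;
  reverse_onto back word.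

Definition push_swapped : cmd :=
  If (ETl word)
    (stack <~ ECons (ECons (EHd (ETl word))
                       (ECons (EHd word) (ETl (ETl word)))) stack)
    (stack <~ ECons word stack).

Definition visit_rotations : cmd :=
  todo <~ word ;;
  foreach todo (visited <~ ECons word visited ;; push_swapped ;; rotate_word).

Definition lookup_word : cmd :=
  found <~ ENil ;;
  todo <~ visited ;;
  foreach todo (If (EEq word (EHd todo)) (found <~ ECons ENil ENil) Skip).

Definition search_step : cmd :=
  word <~ EHd stack ;;
  stack <~ ETl stack ;;
  lookup_word ;;
  If found Skip
    (output <~ ECons word output ;;
     remaining <~ ETl remaining ;;
     visit_rotations).

Definition build_word : cmd :=
  foreach counts
    (tally <~ EHd counts ;;
     foreach tally (word <~ ECons letter word) ;;
     letter <~ ECons ENil letter).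

Definition search_prog : cmd :=
  remaining <~ EHd output ;;
  counts <~ ETl output ;;
  output <~ ENil ;;
  build_word ;;
  stack <~ ECons word ENil ;;
  While remaining search_step.

(** * Rotations and rearrangements *)

Section Rotations.
Variable T : eqType.
Implicit Types (w u v : seq T) (O C : seq (seq T)).

Definition rotations w : seq (seq T) := [seq rot i w | i <- iota 0 (size w)].

Lemma size_rotations w : size (rotations w) = size w.
Proof. by rewrite size_map size_iota. Qed.

Lemma rot_in_rotations i w : 0 < size w -> rot i w \in rotations w.
Proof.
move=> w0; have [iw|wi] := ltnP i (size w).
  by apply: map_f; rewrite mem_iota.
rewrite rot_oversize // -{1}[w]rot0.
by apply: map_f; rewrite mem_iota.
Qed.

Lemma rotations_refl w : 0 < size w -> w \in rotations w.
Proof. by move/(rot_in_rotations 0); rewrite rot0. Qed.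

Lemma rotations_sym u w : u \in rotations w -> w \in rotations u.
Proof.
case/mapP=> i; rewrite mem_iota => /andP[_ iw] ->.
by rewrite -{1}[w](rotK i) rot_in_rotations // size_rot (leq_trans _ iw).
Qed.

Lemma rotations_trans u v w :
  u \in rotations v -> v \in rotations w -> u \in rotations w.
Proof.
case/mapP=> i _ -> /mapP[j]; rewrite mem_iota => /andP[_ jw] ->.
rewrite [rot i _]rot_minn [rot j _]rot_minn size_rot.
rewrite rot_add_mod ?geq_minr //.
by case: ifP => _; apply: rot_in_rotations; apply: leq_ltn_trans jw.
Qed.

Lemma rotations_rot i u w : u \in rotations w -> rot i u \in rotations w.
Proof.
move=> uw; apply: rotations_trans (uw); apply: rot_in_rotations.
case/mapP: uw => j; rewrite mem_iota => /andP[_ jw] ->.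
by rewrite size_rot; lia.
Qed.

Lemma rotations_perm u w : u \in rotations w -> perm_eq u w.
Proof. by case/mapP=> i _ ->; rewrite perm_rot. Qed.

Definition swap_head w : seq T :=
  if w is x :: y :: z then y :: x :: z else w.

Lemma perm_swap_head w : perm_eq (swap_head w) w.
Proof.
by case: w => [|x [|y z]] //=; apply/permP => a /=; rewrite addnCA.
Qed.

Definition neighbours w : seq (seq T) := map swap_head (rotations w).

(* Rotating, swapping the first two letters and rotating back exchanges two
   adjacent letters, and adjacent exchanges reach every rearrangement. *)
Lemma rearrangement_ind (V : pred (seq T)) :
  (forall i u, V u -> V (rot i u)) -> (forall u, V u -> V (swap_head u)) ->
  forall w u, V w -> perm_eq u w -> V u.
Proof.
move=> Vrot Vswap.
have exchange p a b y : V (p ++ a :: b :: y) -> V (p ++ b :: a :: y).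
  move=> /(Vrot (size p)); rewrite rot_size_cat => /Vswap /=.
  by move=> /(Vrot (size (b :: a :: y))); rewrite -!cat_cons rot_size_cat.
have move_front p x a y : V (p ++ x ++ a :: y) -> V (p ++ a :: x ++ y).
  elim/last_ind: x y => [|x b IH] y //.
  rewrite cat_rcons catA => /exchange; rewrite -catA => /IH.
  by rewrite cat_rcons.
suff rearrange t p w : V (p ++ w) -> perm_eq t w -> V (p ++ t).
  by move=> w u; apply: (rearrange u [::] w).
elim: t p w => [|a t IH] p w Vw; first by rewrite perm_sym => /perm_nilP <-.
move=> tw; have aw : a \in w by rewrite -(perm_mem tw) mem_head.
case/splitPr: aw Vw tw => x y /move_front Vw tw.
rewrite -cat_rcons; apply: (IH _ (x ++ y)); first by rewrite cat_rcons.
rewrite -(perm_cons a); apply: (perm_trans tw).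
by rewrite perm_catC /= perm_cons perm_catC.
Qed.

Definition rotation_free O : bool :=
  pairwise (fun u v => u \notin rotations v) O.

(* The program puts each new word in front, which reverses the rotations. *)
Definition rotations_of O : seq (seq T) :=
  flatten [seq rev (rotations o) | o <- O].

Lemma rotations_ofP O u :
  reflect (exists2 o, o \in O & u \in rotations o) (u \in rotations_of O).
Proof.
apply: (iffP flatten_mapP) => -[o oO uo]; exists o => //;
  by move: uo; rewrite mem_rev.
Qed.

Lemma rotations_of_cons o O u :
  (u \in rotations_of (o :: O)) = (u \in rotations o) || (u \in rotations_of O).
Proof. by rewrite /rotations_of /= mem_cat mem_rev. Qed.

Lemma size_rotations_of l O : {in O, forall o, size o = l} ->
  size (rotations_of O) = size O * l.
Proof.
elim: O => //= o O IH Ol; rewrite size_cat size_rev size_rotations mulSn.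
by rewrite Ol ?mem_head // IH // => u uO; rewrite Ol // inE uO orbT.
Qed.

End Rotations.

(** * The search on lists of words *)

Section SearchInvariant.
Variables (T : eqType) (w0 : seq T).
Hypothesis w0_gt0 : 0 < size w0.
Implicit Types (w u : seq T) (O C : seq (seq T)).

(* O lists the words found so far and C the candidates still on the stack. *)
Record search_invariant O C : Prop := {
  found_perm : {in O, forall u, perm_eq u w0};
  candidate_perm : {in C, forall u, perm_eq u w0};
  found_rotation_free : rotation_free O;
  start_reached : (w0 \in rotations_of O) || (w0 \in C);
  swap_reached : {in rotations_of O, forall u,
    (swap_head u \in rotations_of O) || (swap_head u \in C)} }.

Lemma search_invariant_start : search_invariant [::] [:: w0].
Proof. by split=> // [u /[!inE] /eqP -> //|]; rewrite mem_head. Qed.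

Lemma search_invariant_skip O w C : w \in rotations_of O ->
  search_invariant O (w :: C) -> search_invariant O C.
Proof.
move=> wO [Ow Cw dO start swap].
have drop u : (u \in rotations_of O) || (u \in w :: C) ->
    (u \in rotations_of O) || (u \in C).
  by rewrite inE => /or3P[->|/eqP ->|->]; rewrite ?wO ?orbT.
split=> // [u uC||u uO]; [|exact: drop|by apply/drop/swap].
by apply: Cw; rewrite inE uC orbT.
Qed.

Lemma search_invariant_visit O w C : w \notin rotations_of O ->
  search_invariant O (w :: C) ->
  search_invariant (w :: O) (rev (neighbours w) ++ C).
Proof.
move=> wO [Ow Cw dO start swap].
have ww0 : perm_eq w w0 by apply: Cw; rewrite mem_head.
have w_gt0 : 0 < size w by rewrite (perm_size ww0).
have keep u : (u \in rotations_of O) || (u \in w :: C) ->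
    (u \in rotations_of (w :: O)) ||
    (u \in rev (neighbours w) ++ C).
  rewrite rotations_of_cons mem_cat inE => /or3P[->|/eqP ->|->].
  - by rewrite orbT.
  - by rewrite rotations_refl.
  - by rewrite !orbT.
split.
- by move=> u; rewrite inE => /predU1P[->|/Ow].
- move=> u; rewrite mem_cat mem_rev => /orP[/mapP[v vw ->]|uC].
    apply: perm_trans (perm_swap_head v) (perm_trans _ ww0).
    exact: rotations_perm.
  by apply: Cw; rewrite inE uC orbT.
- rewrite /rotation_free /= [X in _ && X]dO andbT; apply/allP => o oO.
  apply: contra wO => wo.
  by apply/rotations_ofP; exists o.
- exact: keep.
- move=> u; rewrite (rotations_of_cons w O u).
  case/orP=> [uw|uO]; last exact/keep/swap.
  by apply/orP; right; rewrite mem_cat mem_rev map_f.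
Qed.

Lemma search_invariant_exhausted O : search_invariant O [::] ->
  forall u, perm_eq u w0 -> u \in rotations_of O.
Proof.
move=> [_ _ _ start swap] u; rewrite orbF in start.
apply: rearrangement_ind start => [i v /rotations_ofP[o oO vo]|v /swap].
  by apply/rotations_ofP; exists o => //; apply: rotations_rot.
by rewrite orbF.
Qed.

End SearchInvariant.

(** * Correctness of the search program *)

Lemma tree_eqP (t u : tree) : reflect (t = u) (tree_eqb t u).
Proof.
apply: (iffP idP) => [|<-]; last by elim: t => //= ? -> ? ->.
by elim: t u => [|a IHa b IHb] [|c d] //= /andP[/IHa -> /IHb ->].
Qed.

Lemma enc_seq_inj : injective enc_seq.
Proof. by elim=> [|x s IH] [|y r] //= [-> /IH ->]. Qed.

Lemma enc_nat_inj : injective enc_nat.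
Proof. by move=> m n /enc_seq_inj /(congr1 size); rewrite !size_nseq. Qed.

Lemma halts_reverse_onto x y ts us s :
  x != y -> s x = enc_seq ts -> s y = enc_seq us ->
  halts (reverse_onto x y) s (fun s' t =>
    s' y = enc_seq (catrev ts us) /\ t <= 11 * size ts + 2).
Proof.
move=> xy sx sy.
pose I ts' s := exists2 us', s y = enc_seq us' & catrev ts' us' = catrev ts us.
apply: (halts_frame (@halts_foreach _ id I _ _ 5 s ts _ _ _ _)).
- by rewrite inE.
- by rewrite map_id.
- by exists us.
- move=> r rs s1 _ s1x [us' s1y usE]; apply: halts_assign; split=> //.
  by exists (r :: us'); rewrite //= eq_sym (negPf xy) eqxx s1x s1y.
- by move=> s' t [[us' -> /= ->] tT] _; split=> //; lia.
Qed.

Section WordPrograms.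
Variables (T : eqType) (e : T -> tree).
Hypothesis e_inj : injective e.
Implicit Types (w u : seq T) (V C O : seq (seq T)) (s : store).

Definition tree_of_word w : tree := enc_seq (map e w).
Definition tree_of_words V : tree := enc_seq (map tree_of_word V).

Lemma tree_of_word_inj : injective tree_of_word.
Proof. by move=> u w /enc_seq_inj /(inj_map e_inj). Qed.

Lemma halts_rotate_word w s : 0 < size w -> s word = tree_of_word w ->
  halts rotate_word s (fun s' t =>
    s' word = tree_of_word (rot 1 w) /\ t <= 22 * size w + 10).
Proof.
case: w => // a w _ sw.
do 3 apply/halts_seq/halts_assign; apply: halts_seq => /=; rewrite sw /=.
apply: halts_frame.
  by apply: (@halts_reverse_onto front back (map e w) [::]).
move=> s1 t1 [s1b t1T] fr1; apply: halts_frame.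
  apply: (halts_reverse_onto (us := [:: e a])) => //; first exact: s1b.
  by rewrite (fr1 word).
move=> s2 t2 [-> t2T] _; split.
  by rewrite !catrevE cats0 revK /tree_of_word rot1_cons -cats1 map_cat.
by move: t2T; rewrite catrevE cats0 size_rev !size_map /= in t1T *; lia.
Qed.

Lemma halts_push_swapped w C s :
  s word = tree_of_word w -> s stack = tree_of_words C ->
  halts push_swapped s (fun s' t =>
    s' stack = tree_of_words (swap_head w :: C) /\ t <= 30).
Proof.
move=> sw sC; apply: halts_if => /=; rewrite sw.
by case: w sw => [|a [|b w]] sw; apply: halts_assign; rewrite /= sw sC.
Qed.

Lemma halts_visit_rotations w V C s : 0 < size w ->
  s word = tree_of_word w -> s visited = tree_of_words V ->
  s stack = tree_of_words C ->
  halts visit_rotations s (fun s' t =>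
    [/\ s' visited = tree_of_words (rev (rotations w) ++ V),
        s' stack = tree_of_words (rev (neighbours w) ++ C)
      & t <= size w * (22 * size w + 60) + 10]).
Proof.
move=> w0 sw sV sC; apply/halts_seq/halts_assign.
pose seen i := [seq rot j w | j <- iota 0 i].
have seenS i : seen i.+1 = rcons (seen i) (rot i w).
  by rewrite /seen -addn1 iotaD map_cat cats1.
pose I (rs : seq T) s1 := exists i,
  [/\ i + size rs = size w, s1 word = tree_of_word (rot i w),
      s1 visited = tree_of_words (rev (seen i) ++ V)
    & s1 stack = tree_of_words (rev (map (@swap_head T) (seen i)) ++ C)].
apply: (halts_frame (@halts_foreach _ e I _ _ (22 * size w + 50) _ w _ _ _ _)).
- by [].
- by [].
- by exists 0; rewrite rot0.
- move=> r rs s1 _ _ [i [iw s1w s1V s1C]].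
  have ilt : i < size w by rewrite -iw /= addnS ltnS leq_addr.
  apply/halts_seq/halts_assign/halts_seq/(halts_frame (@halts_push_swapped
    (rot i w) (rev (map (@swap_head T) (seen i)) ++ C) _ _ _)) => //=.
  move=> s2 t2 [s2C t2T] fr2.
  apply: (halts_frame (@halts_rotate_word (rot i w) _ _ _)).
  + by rewrite size_rot.
  + by rewrite (fr2 word).
  move=> s3 t3 [s3w t3T] fr3; split; last by rewrite size_rot in t3T; lia.
  exists i.+1; rewrite seenS map_rcons !rev_rcons /= s3w -rotS //.
  rewrite (fr3 visited) // (fr3 stack) // (fr2 visited) // s2C /= s1w s1V.
  by rewrite -iw addSnnS.
- move=> s' t [[i [+ _ -> ->]] tT] _; rewrite addn0 => ->; split=> //.
  by rewrite /=; lia.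
Qed.

Lemma halts_lookup_word w V N s :
  s word = tree_of_word w -> s visited = tree_of_words V ->
  {in w :: V, forall u, tree_size (tree_of_word u) <= N} ->
  halts lookup_word s (fun s' t =>
    tree_true (s' found) = (w \in V) /\ t <= size V * (2 * N + 20) + 10).
Proof.
move=> sw sV treeN; do 2 apply/halts_seq/halts_assign.
pose I (rs : seq (seq T)) s1 := {subset rs <= V} /\
  (tree_true (s1 found) || (w \in rs)) = (w \in V).
apply: (halts_frame (@halts_foreach _ tree_of_word I _ _ (2 * N + 10) _ V
  _ _ _ _)).
- by [].
- by [].
- by split.
- move=> u rs s1 fr1 s1u [rsV fV]; apply: halts_if => /=.
  have s1w : s1 word = tree_of_word w by rewrite (fr1 word) /=.
  have wN := treeN w (mem_head _ _).
  have uN : tree_size (tree_of_word u) <= N.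
    by apply: treeN; rewrite inE rsV ?mem_head ?orbT.
  have subV : {subset rs <= V}.
    by move=> v vrs; apply: rsV; rewrite inE vrs orbT.
  rewrite s1w s1u /=; have -> : tree_eqb (tree_of_word w) (tree_of_word u) =
      (w == u) by apply/tree_eqP/eqP => [/tree_of_word_inj|->].
  case: eqVneq fV => [wu|wu] fV.
    apply: halts_assign; split; last by rewrite /=; lia.
    by split=> //=; rewrite wu rsV ?mem_head.
  apply: halts_skip; split; last by lia.
  by split=> //=; rewrite -fV inE (negPf wu).
- by move=> s' t [[_ <-] tT] _; rewrite orbF; split=> //=; lia.
Qed.

Definition search_state n O C s : Prop :=
  [/\ s output = tree_of_words O, s remaining = enc_nat n,
      s stack = tree_of_words C
    & s visited = tree_of_words (rotations_of O)].

Lemma halts_search_step n O w C N s : 0 < size w ->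
  {in w :: rotations_of O, forall u, tree_size (tree_of_word u) <= N} ->
  search_state n.+1 O (w :: C) s ->
  halts search_step s (fun s' t =>
    (if w \in rotations_of O then search_state n.+1 O C s' else
     search_state n (w :: O) (rev (neighbours w) ++ C) s')
    /\ t <= size (rotations_of O) * (2 * N + 20)
            + size w * (22 * size w + 60) + 60).
Proof.
move=> w0 treeN [sO sn sC sV].
do 2 apply/halts_seq/halts_assign; rewrite /= sC /=; apply: halts_seq.
apply: (halts_frame (@halts_lookup_word w (rotations_of O) N _ _ _ _)) => //.
move=> s1 t1 [s1f t1T] fr1; apply: halts_if => /=; rewrite s1f.
have s1w : s1 word = tree_of_word w by rewrite fr1.
have s1C : s1 stack = tree_of_words C by rewrite fr1 //= sC.
have s1V : s1 visited = tree_of_words (rotations_of O) by rewrite fr1.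
have s1O : s1 output = tree_of_words O by rewrite fr1.
have s1n : s1 remaining = enc_nat n.+1 by rewrite fr1.
case: ifP => _.
  by apply: halts_skip; split=> //; lia.
do 2 apply/halts_seq/halts_assign; rewrite /= s1w s1O s1n /=.
apply: (halts_frame (@halts_visit_rotations w (rotations_of O) C _ _ _ _ _))
  => //.
move=> s2 t2 [s2V s2C t2T] fr2; split; last by rewrite /=; lia.
by split; rewrite // fr2.
Qed.

Lemma tree_size_word w :
  tree_size (tree_of_word w) = (sumn [seq (tree_size (e x)).+1 | x <- w]).+1.
Proof. by elim: w => //= x w; rewrite /tree_of_word => ->; rewrite addnS. Qed.

Lemma perm_tree_size u w :
  perm_eq u w -> tree_size (tree_of_word u) = tree_size (tree_of_word w).
Proof. by move=> uw; rewrite !tree_size_word (perm_sumn (perm_map _ uw)). Qed.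

Section Search.
Variables (w0 : seq T) (k : nat).
Hypothesis w0_gt0 : 0 < size w0.
Hypothesis enough_classes : forall O,
  (forall u, perm_eq u w0 -> u \in rotations_of O) -> k <= size O.
Local Notation l := (size w0).

(* A step pops one candidate; if it pushes l new ones, it also uses up one of
   the n words still to be found. *)
Definition loop_invariant m s : Prop := exists n O C,
  [/\ m = size C + l * n, n + size O = k, search_invariant w0 O C
    & search_state n O C s].

Definition step_time : nat :=
  k * l * (2 * tree_size (tree_of_word w0) + 20) + l * (22 * l + 60) + 60.

Lemma loop_invariant_step m s : loop_invariant m s -> tree_true (s remaining) ->
  halts search_step s (fun s' t =>
    (exists2 m', m' < m & loop_invariant m' s') /\ t <= step_time).
Proof.
case=> n [O [C [-> nO inv st]]]; have [_ -> _ _] := st.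
case: n nO st => // n nO st _.
have [Ow Cw _ _ _] := inv.
case: C => [|w C] in Cw inv st *.
  by have := enough_classes (search_invariant_exhausted inv); rewrite -nO; lia.
have ww0 : perm_eq w w0 by apply: Cw; rewrite mem_head.
have szO : size (rotations_of O) <= k * l.
  rewrite (@size_rotations_of _ l) => [|o /Ow /perm_size //].
  by rewrite leq_mul2r -nO leq_addl orbT.
apply: (halts_frame (@halts_search_step n O w C (tree_size (tree_of_word w0)) s
  _ _ st)).
- by rewrite (perm_size ww0).
- move=> u; rewrite inE => /predU1P[->|/rotations_ofP[o oO uo]].
    by rewrite (perm_tree_size ww0).
  by rewrite (perm_tree_size (perm_trans (rotations_perm uo) (Ow o oO))).
move=> s' t [st' tT] _; split; last first.
  apply: leq_trans tT _.
  by rewrite (perm_size ww0) !leq_add2r leq_mul2r szO orbT.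
case: ifPn st' => wO st'.
  exists (size C + l * n.+1) => //; exists n.+1, O, C; split=> //.
  exact: search_invariant_skip inv.
exists (size C + l * n.+1); first by rewrite addSn.
exists n, (w :: O), (rev (neighbours w) ++ C); split=> //.
- rewrite size_cat size_rev size_map size_rotations (perm_size ww0) mulnS.
  by lia.
- by rewrite -nO addSnnS.
- exact: search_invariant_visit.
Qed.

Lemma halts_search s : search_state k [::] [:: w0] s ->
  halts (While remaining search_step) s (fun s' t =>
    exists O, [/\ s' output = tree_of_words O, size O = k,
      {in O, forall u, perm_eq u w0}, rotation_free O
    & t <= (l * k).+1 * step_time.+2 + 2]).
Proof.
move=> st; have I0 : loop_invariant (l * k).+1 s.
  exists k, [::], [:: w0]; split=> //; first by rewrite addn0.
  exact: search_invariant_start.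
apply: (halts_frame (halts_while loop_invariant_step I0)).
move=> s' t [[m [n [O [C [_ nO [Ow _ dO _ _] [sO sn _ _]]]]]] ns tT] _.
by exists O; split=> //; rewrite sn in ns; case: n {sn} ns nO.
Qed.

End Search.

End WordPrograms.

Lemma tree_size_enc_nat n : tree_size (enc_nat n) = n.*2.+1.
Proof. by elim: n => //= n ->; rewrite doubleS. Qed.

Lemma tree_size_enc_word q (w : seq 'I_q) :
  tree_size (enc_word w) <= (size w * (2 * q)).+1.
Proof.
elim: w => //= i w IH; rewrite tree_size_enc_nat /enc_word /= in IH *.
by have := ltn_ord i; rewrite mulSn; lia.
Qed.

Lemma search_time_le q l k N M : 0 < M -> q <= M -> l <= M -> k <= M ->
  N <= (l * (2 * q)).+1 ->
  q * (11 * l + 30) + (l * k).+1 * (k * l * (2 * N + 20)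
    + l * (22 * l + 60) + 60).+2 + 32 <= 500 * M ^ 6.
Proof.
move=> M0 qM lM kM NM; set step := (_ + 60).+2.
have lkA := leq_mul lM kM; have lqA := leq_mul lM qM; have llA := leq_mul lM lM.
have MA : M <= M * M by rewrite leq_pmulr.
have A0 : 0 < M * M by rewrite muln_gt0 M0.
have -> : M ^ 6 = M * M * (M * M * (M * M)) by rewrite !mulnn -!expnM -expnD.
move: (M * M) A0 MA lkA lqA llA => A A0 MA lkA lqA llA.
have AA : A <= A * A by rewrite leq_pmulr.
have step_le : step <= 170 * (A * A).
  have N_le : 2 * N + 20 <= 26 * A by lia.
  by have := leq_mul lkA N_le; rewrite /step; lia.
have AAA : A * A <= A * (A * A) by rewrite leq_pmull.
have := leq_mul lkA step_le; move: step step_le => step step_le.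
by rewrite mulSn; lia.
Qed.

Section ParikhVectors.
Variables (q : nat) (P : q.-tuple nat).
Local Notation l := (sumn P).

Definition has_parikh (w : seq 'I_q) : bool :=
  [forall i, count_mem i w == tnth P i].

Lemma has_parikhP w :
  reflect (forall i, count_mem i w = tnth P i) (has_parikh w).
Proof. exact: 'forall_eqP. Qed.

Lemma sumn_tnth : sumn P = \sum_i tnth P i.
Proof. by rewrite sumnE big_tuple. Qed.

Lemma parikh_le i : tnth P i <= l.
Proof. by rewrite sumn_tnth (bigD1 i) //= leq_addr. Qed.

Lemma exists_two_most_frequent : 2 <= q -> exists x y : 'I_q,
  [/\ x != y, tnth P y <= tnth P x, l <= q * tnth P x
    & l <= tnth P x + q * tnth P y].
Proof.
move=> q2; pose i0 := Ordinal (ltnW q2); pose i1 := Ordinal q2.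
have [x _ xmax] := @arg_maxnP _ i0 predT (tnth P) isT.
have [j jx] : exists j : 'I_q, j != x.
  by case: (eqVneq i0 x) => [<-|]; [exists i1 | exists i0].
have [y yx ymax] := @arg_maxnP _ j [pred i | i != x] (tnth P) jx.
exists x, y; split; rewrite 1?eq_sym //; first exact: xmax.
  rewrite sumn_tnth (@leq_trans (\sum_(i < q) tnth P x)) //.
    by apply: leq_sum => i _; apply: xmax.
  by rewrite sum_nat_const card_ord.
rewrite sumn_tnth (bigD1 x) //= leq_add2l.
rewrite (@leq_trans (\sum_(i < q | i != x) tnth P y)) //.
  by apply: leq_sum => i ix; apply: ymax.
by rewrite sum_nat_const leq_mul2r -[X in _ <= X]card_ord max_card orbT.
Qed.

Lemma size_has_parikh w : has_parikh w -> size w = l.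
Proof.
move/has_parikhP => wP.
rewrite -sum1_size (partition_big id predT) //= sumn_tnth.
by apply: eq_bigr => i _; rewrite -wP sum1_count.
Qed.

Lemma perm_has_parikh u w : has_parikh w -> perm_eq u w = has_parikh u.
Proof.
move/has_parikhP => wP; apply/idP/has_parikhP => [/permP uw i|uP].
  by rewrite uw wP.
by apply/allP => x _ /=; rewrite uP wP.
Qed.

Definition decreasing_word (ds : seq 'I_q) : seq 'I_q :=
  flatten [seq nseq (tnth P i) i | i <- rev ds].

Lemma decreasing_word_rcons ds i :
  decreasing_word (rcons ds i) = nseq (tnth P i) i ++ decreasing_word ds.
Proof. by rewrite /decreasing_word rev_rcons. Qed.

Lemma has_parikh_decreasing_word : has_parikh (decreasing_word (enum 'I_q)).
Proof.
apply/has_parikhP => j; rewrite count_flatten -map_comp sumnE big_map.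
rewrite (perm_big (enum 'I_q)) ?perm_rev //= big_enum /=.
rewrite (bigD1 j) //= count_nseq /= eqxx mul1n big1 ?addn0 // => i /negPf ij.
by rewrite count_nseq /= ij.
Qed.

Lemma halts_fill n ts s : s tally = enc_nat n -> s word = enc_seq ts ->
  halts (foreach tally (word <~ ECons letter word)) s (fun s' t =>
    s' word = enc_seq (nseq n (s letter) ++ ts) /\ t <= 11 * n + 2).
Proof.
move=> sn sw; pose I (rs : seq tree) s1 := exists m,
  m + size rs = n /\ s1 word = enc_seq (nseq m (s letter) ++ ts).
apply: (halts_frame (@halts_foreach _ id I _ _ 5 s (nseq n Nil) _ _ _ _)).
- by [].
- by rewrite map_id.
- by exists 0; rewrite size_nseq.
- move=> r rs s1 fr1 _ [m [mn s1w]]; apply: halts_assign; split=> //.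
  by exists m.+1; rewrite /= s1w (fr1 letter) // addSnnS.
- move=> s' t [[m [+ ->]] tT] _; rewrite addn0 => ->; split=> //.
  by rewrite size_nseq in tT; lia.
Qed.

Lemma halts_build_word s : s counts = enc_seq (map enc_nat P) ->
  s letter = Nil -> s word = Nil ->
  halts build_word s (fun s' t =>
    s' word = enc_word (decreasing_word (enum 'I_q)) /\
    t <= q * (11 * l + 30) + 2).
Proof.
move=> sP si sw; pose I rs s1 := exists ds,
  [/\ enum 'I_q = ds ++ rs, s1 letter = enc_nat (size ds)
    & s1 word = enc_word (decreasing_word ds)].
apply: (halts_frame (@halts_foreach _ (enc_nat \o tnth P) I _ _ (11 * l + 24)
  s (enum 'I_q) _ _ _ _)).
- by [].
- by rewrite map_comp map_tnth_enum.
- by exists [::].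
- move=> i rs s1 fr1 s1P [ds [dsE s1i s1w]].
  apply/halts_seq/halts_assign/halts_seq.
  apply: (halts_frame (@halts_fill (tnth P i) _ _ _ s1w)).
    by rewrite /= s1P.
  move=> s2 t2 [s2w t2T] fr2; apply: halts_assign; split; last first.
    by have := parikh_le i; rewrite /=; lia.
  have ds_lt : size ds < q.
    by rewrite -[X in _ < X]size_enum_ord dsE size_cat /= -addSnnS leq_addr.
  have iE : i = size ds :> nat.
    by rewrite -(nth_enum_ord i ds_lt) dsE nth_cat ltnn subnn.
  exists (rcons ds i); rewrite /= cat_rcons size_rcons (fr2 letter) //= s1i.
  split=> //; rewrite s2w decreasing_word_rcons /= s1i -iE.
  by rewrite /enc_word map_cat map_nseq.
- move=> s' t [[ds [dsE _ ->]] tT] _; rewrite cats0 in dsE.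
  by rewrite -dsE; split=> //; rewrite size_enum_ord in tT; lia.
Qed.

Lemma halts_search_prog k : 0 < l ->
  (forall O, (forall u, has_parikh u -> u \in rotations_of O) -> k <= size O) ->
  halts search_prog (update (fun _ => Nil) 0 (enc_instance P k)) (fun s t =>
    exists O, [/\ s output = enc_seq (map (@enc_word q) O), size O = k,
      {in O, forall u, has_parikh u}, rotation_free O
    & t <= 500 * (q + l + k) ^ 6]).
Proof.
move=> l0 enough; set w0 := decreasing_word (enum 'I_q).
have w0P : has_parikh w0 := has_parikh_decreasing_word.
have sz0 := size_has_parikh w0P.
pose encode_letter (i : 'I_q) := enc_nat i.
have enc_inj : injective encode_letter by move=> i j /enc_nat_inj /val_inj.
do 3 apply/halts_seq/halts_assign; apply: halts_seq.
apply: (halts_frame (halts_build_word _ _ _)) => // s1 t1 [s1w t1T] fr1.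
apply/halts_seq/halts_assign; rewrite /= s1w.
apply: (halts_frame (@halts_search _ _ enc_inj w0 k _ _ _ _)).
- by rewrite sz0.
- move=> O coverO; apply: enough => u uP; apply: coverO.
  by rewrite perm_has_parikh.
- by split; rewrite //= fr1.
move=> s' t [O [sO szO Ow dO tT]] _; exists O; split=> //.
  by move=> u uO; rewrite -(perm_has_parikh u w0P) Ow.
rewrite /step_time sz0 in tT.
have N_le : tree_size (tree_of_word encode_letter w0) <= (l * (2 * q)).+1.
  by rewrite -sz0; exact: tree_size_enc_word.
have := search_time_le (leq_trans l0 _) _ _ _ N_le (M := q + l + k) (k := k).
by lia.
Qed.

End ParikhVectors.

(** * Common factors of two words *)

Section Factors.
Variable T : eqType.
Implicit Types (a b u B : seq T) (cs : seq (seq T)) (n G : nat).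

Definition factors n a : seq (seq T) := [seq take n u | u <- rotations a].

Lemma size_factors n a : size (factors n a) = size a.
Proof. by rewrite size_map size_rotations. Qed.

Lemma factorsE n a :
  factors n a = [seq cyclic_factor a n i | i <- iota 0 (size a)].
Proof. by rewrite /factors -map_comp. Qed.

Lemma size_cyclic_factor a n i : n <= size a -> size (cyclic_factor a n i) = n.
Proof. by move=> na; rewrite size_takel // size_rot. Qed.

Lemma take_factors m n a u : n <= m -> u \in factors m a ->
  take n u \in factors n a.
Proof. by move=> nm /mapP[r ra ->]; rewrite take_takel // map_f. Qed.

Lemma factors_rotations u a n : u \in rotations a -> factors n u =i factors n a.
Proof.
move=> ua; have au := rotations_sym ua.
by move=> f; apply/mapP/mapP => -[r ru ->]; exists r => //;
  apply: rotations_trans ru _.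
Qed.

Definition factor_disjoint n a b : bool :=
  ~~ has [in factors n a] (factors n b).

Lemma factor_disjoint_sym n a b : factor_disjoint n a b = factor_disjoint n b a.
Proof. by rewrite /factor_disjoint has_sym. Qed.

Lemma factor_disjoint_rotations n a b a' b' :
  a' \in rotations a -> b' \in rotations b ->
  factor_disjoint n a' b' = factor_disjoint n a b.
Proof.
move=> /factors_rotations aa' /factors_rotations bb'; rewrite /factor_disjoint.
by rewrite (eq_has (aa' n)) (eq_has_r (bb' n)).
Qed.

Lemma mem_factors_infix B n a u :
  u \in factors n a -> infix B u -> B \in factors (size B) a.
Proof.
case/mapP=> r ra -> /infixP[x [y ruE]].
apply/mapP; exists (rot (size x) r); first exact: rotations_rot.
by rewrite -[r](cat_take_drop n) ruE -!catA rot_size_cat -catA take_size_cat.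
Qed.

Lemma nth_rotC x0 a i j : i < size a -> j < size a ->
  nth x0 (rot i a) j = nth x0 (rot j a) i.
Proof.
move=> ia ja; rewrite /rot !nth_cat !size_drop !nth_drop.
case: ltnP => ?; case: ltnP => ?; try lia; first by rewrite addnC.
by rewrite !nth_take; [congr nth|..]; lia.
Qed.

Lemma map_nth_rotations x0 a i : i < size a ->
  [seq nth x0 u i | u <- rotations a] = rot i a.
Proof.
move=> ia; have sz : size a = size (rot i a) by rewrite size_rot.
rewrite /rotations -map_comp -[RHS](mkseq_nth x0) -sz.
apply/eq_in_map => j; rewrite mem_iota => /andP[_ ja] /=.
by rewrite nth_rotC.
Qed.

(* Each letter other than x spoils at most n of the factors of length n. *)
Lemma count_constant_factors_ge a x n : n <= size a ->
  size a <= count_mem (nseq n x) (factors n a) + n * count (predC1 x) a.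
Proof.
elim: n => [|n IH] na.
  rewrite (eq_in_count (a2 := predT)) ?count_predT ?size_factors ?leq_addr //.
  by move=> u /mapP[r _ ->]; rewrite take0.
apply: leq_trans (IH (ltnW na)) _; rewrite mulSnr addnA addnAC leq_add2r.
have <- : count (fun u => nth x u n != x) (rotations a) = count (predC1 x) a.
  rewrite -(permP (permEl (perm_rot n a))) -(map_nth_rotations x na).
  by rewrite count_map.
rewrite /factors /rotations !count_map -count_predUI.
apply: leq_trans (leq_addr _ _); apply: sub_count => i /= /eqP take_n.
rewrite (take_nth x) ?size_rot // take_n.
have [->|] := eqVneq (nth x (rot i a) n) x; rewrite ?orbT //.
by rewrite -cats1 -(nseqD n 1) addn1 eqxx.
Qed.

(** * Words with planted copies of a factor *)

Definition planted B cs : seq T := flatten [seq B ++ w | w <- cs].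

Lemma count_planted p B cs :
  count p (planted B cs) = size cs * count p B + count p (flatten cs).
Proof.
rewrite /planted; elim: cs => //= w cs IH; rewrite !count_cat IH mulSn; lia.
Qed.

(* z stands for what follows the planted word when it is read cyclically. *)
Lemma infix_planted_suffix B cs G x y z :
  all (fun w => size w <= G) cs -> x ++ y = planted B cs -> prefix B z ->
  infix B (take (2 * size B + G) (y ++ z)).
Proof.
move=> + + /prefixP[z' ->]; elim: cs x => [|w cs IH] x /=.
  move=> _ /(congr1 size); rewrite size_cat => /eqP.
  rewrite addn_eq0 => /andP[_ /nilP ->] /=; rewrite take_cat ifF; last by lia.
  exact: prefix_infix.
case/andP=> wG csG; rewrite /planted /= -/(planted B cs) => E.
have [sx|sx] := leqP (size (B ++ w)) (size x).
  apply: (IH (drop (size (B ++ w)) x)) => //.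
  have := congr1 (drop (size (B ++ w))) E.
  rewrite [in RHS]drop_size_cat // => <-.
  by rewrite drop_cat; case: ltngtP sx => // ->; rewrite subnn drop0 drop_size.
have -> : y = drop (size x) (B ++ w) ++ planted B cs.
  by have := congr1 (drop (size x)) E; rewrite drop_size_cat // drop_cat sx.
have [r planted_r] : exists r, planted B cs ++ B ++ z' = B ++ r.
  by case: (cs) => [|w' cs']; rewrite /planted /= -?catA; eexists.
rewrite -catA planted_r take_cat ifF; last by rewrite size_drop size_cat; lia.
apply/infix_catl; rewrite take_cat ifF; last by rewrite size_drop size_cat; lia.
exact: prefix_infix.
Qed.

Lemma infix_planted B cs G : cs != [::] -> all (fun w => size w <= G) cs ->
  2 * size B + G <= size (planted B cs) ->
  {in factors (2 * size B + G) (planted B cs), forall u, infix B u}.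
Proof.
move=> cs0 csG; set v := planted B cs => nv _ /mapP[_ /mapP[i _ ->] ->].
have -> : take (2 * size B + G) (rot i v) =
    take (2 * size B + G) (drop i v ++ v).
  by rewrite -[X in _ ++ X](cat_take_drop i v) catA takel_cat ?size_rot.
apply: infix_planted_suffix csG _ _; first exact: cat_take_drop.
rewrite /v; case: (cs) cs0 => // w cs' _.
by rewrite /planted /= -catA prefix_prefix.
Qed.

Lemma planted_factor_disjoint B cs G b (n := 2 * size B + G) :
  cs != [::] -> all (fun w => size w <= G) cs -> n <= size (planted B cs) ->
  B \notin factors (size B) b ->
  factor_disjoint n (planted B cs) b.
Proof.
move=> cs0 csG nv; apply: contra => /hasP[u ub /(infix_planted cs0 csG nv)].
exact: mem_factors_infix ub.
Qed.

Lemma exists_avoiding_word x y n (ws : seq (seq T)) :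
  x != y -> size ws < 2 ^ n ->
  exists B, [/\ size B = n, {subset B <= [:: x; y]} & B \notin ws].
Proof.
move=> xy ws_lt.
pose f (t : n.-tuple bool) := [seq if c then x else y | c <- t].
have f_inj : injective f.
  move=> s t /inj_map E; apply/val_inj/E => -[] [] //= /eqP.
    by rewrite (negPf xy).
  by rewrite eq_sym (negPf xy).
have /allPn[B /mapP[t _ ->] Bws] :
    ~~ all [in ws] (map f (enum {: n.-tuple bool})).
  apply: contraL ws_lt => /allP sub; rewrite -leqNgt.
  rewrite -card_bool -card_tuple cardE -(size_map f).
  by apply: uniq_leq_size sub; rewrite map_inj_uniq // enum_uniq.
exists (f t); split=> //; first by rewrite size_map size_tuple.
by move=> z /mapP[c _ ->]; case: c; rewrite !inE eqxx ?orbT.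
Qed.

End Factors.

Lemma exists_chunks (T : Type) n t (w : seq T) : size w <= t * n ->
  exists cs, [/\ flatten cs = w, size cs = t & all (fun u => size u <= n) cs].
Proof.
move=> w_le; exists (reshape (nseq t n) w); split.
- by rewrite reshapeKr // sumn_nseq mulnC.
- by rewrite size_reshape size_nseq.
- apply/(all_nthP [::]) => i _; rewrite nth_reshape size_take_min nth_nseq.
  by case: ifP => _; rewrite ?min0n // geq_minl.
Qed.

(** * Overlap of two words *)

Section Overlaps.
Variable T : choiceType.
Implicit Types (a b : seq T) (x : T).

Definition common_factors a b : {mset (seq T * nat)%type}%mset :=
  (labelled_factors a `&` labelled_factors b)%mset.

Lemma perm_labelled_factors a :
  perm_eq (labelled_factors a)
    [seq (cyclic_factor a n i, occurrence_label a n i)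
    | n <- iota 1 (size a), i <- iota 0 (size a)].
Proof. exact: perm_eq_seq_mset. Qed.

Lemma size_labelled_factors a : size (labelled_factors a) = size a * size a.
Proof.
by rewrite (perm_size (perm_labelled_factors a)) size_allpairs !size_iota.
Qed.

Lemma mem_labelled_factors a z : z \in labelled_factors a ->
  z.1 \in factors (size z.1) a.
Proof.
rewrite (perm_mem (perm_labelled_factors a)) => /allpairsPdep[n [i []]].
rewrite mem_iota add1n ltnS => /andP[_ na] ia -> /=.
by rewrite size_cyclic_factor // factorsE map_f.
Qed.

Lemma count_short_labelled_factors a n : 0 < n <= size a ->
  count (fun z => size z.1 < n) (labelled_factors a) <= n.-1 * size a.
Proof.
move=> /andP[n0 na]; rewrite (permP (perm_labelled_factors a)).
have -> : iota 1 (size a) = iota 1 n.-1 ++ iota n (size a - n.-1).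
  by rewrite {2}(_ : n = 1 + n.-1) -?iotaD; [congr iota; lia | lia].
rewrite map_cat flatten_cat count_cat -[X in _ <= X]addn0; apply: leq_add.
  by apply: leq_trans (count_size _ _) _; rewrite size_allpairs !size_iota.
rewrite leqNgt -has_count; apply/hasPn => z /allpairsPdep[m [i []]].
rewrite !mem_iota => mn _ ->; rewrite /= -leqNgt.
by move: (size a) na mn (@size_cyclic_factor _ a m i) => N ? ? ->; lia.
Qed.

Lemma size_common_factors_le a b n : 0 < n <= size a ->
  factor_disjoint n a b ->
  size (common_factors a b) <= n.-1 * size a.
Proof.
move=> na /hasPn ab; apply: leq_trans (count_short_labelled_factors na).
have short : {in common_factors a b, forall z, (size z.1 < n) = true}.
  move=> z; rewrite in_msetI => /andP[/mem_labelled_factors za].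
  move/mem_labelled_factors => zb; rewrite ltnNge; apply/negP => nz.
  by have /negP := ab _ (take_factors nz zb); apply; apply: take_factors za.
rewrite -(count_predT (common_factors a b)) -(eq_in_count short).
have /count_subseqP[s sub_s /permP ->] : forall z,
    count_mem z (common_factors a b) <= count_mem z (labelled_factors a).
  by move=> z; rewrite !count_mem_mset msetE2 geq_minl.
exact: leq_count_subseq.
Qed.

Lemma count_prefix_surj (p : pred nat) n j : 0 < j <= count p (iota 0 n) ->
  exists i, [/\ i < n, p i & count p (iota 0 i.+1) = j].
Proof.
have countS m : count p (iota 0 m.+1) = count p (iota 0 m) + p m.
  by rewrite -addn1 iotaD count_cat /= addn0.
elim: n => [|n IH]; first by case: j.
rewrite countS => /andP[j0 jle].
have [jn|jn] := leqP j (count p (iota 0 n)).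
  have [|i [ilt pi <-]] := IH; first by rewrite j0.
  by exists i; split=> //; rewrite ltnW.
exists n; have pn : p n by move: jn jle; case: (p n) => //; lia.
by split=> //; move: jn jle; rewrite countS pn; lia.
Qed.

Lemma in_labelled_factors a u j : 0 < size u <= size a ->
  0 < j <= count_mem u (factors (size u) a) -> (u, j) \in labelled_factors a.
Proof.
move=> ua; rewrite factorsE count_map => /count_prefix_surj[i [ia /eqP ui <-]].
rewrite (perm_mem (perm_labelled_factors a)); apply/allpairsPdep.
by exists (size u), i; rewrite !mem_iota /occurrence_label ui; split=> //; lia.
Qed.

Lemma size_common_factors_ge a b x n m : n <= size a -> n <= size b ->
  (forall l, 0 < l <= n -> m <= count_mem (nseq l x) (factors l a) /\
                           m <= count_mem (nseq l x) (factors l b)) ->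
  n * m <= size (common_factors a b).
Proof.
move=> na nb runs.
pose s := [seq (nseq l x, j) | l <- iota 1 n, j <- iota 1 m].
have <- : size s = n * m by rewrite size_allpairs !size_iota.
apply: uniq_leq_size => [|z /allpairsPdep[l [j []]]].
  apply: allpairs_uniq; rewrite ?iota_uniq // => -[l j] [l' j'] _ _ /=.
  by case=> /(congr1 size); rewrite !size_nseq => -> ->.
rewrite !mem_iota => ln jm ->; have [|ma mb] := runs l; first lia.
by rewrite in_msetI !in_labelled_factors // !size_nseq; lia.
Qed.

Lemma common_runs_ge a b x c m :
  size b = size a -> c <= count_mem x a -> c <= count_mem x b ->
  size a <= c + m -> 0 < m -> c * c <= 4 * m * size (common_factors a b).
Proof.
have [-> //|c0] := posnP c.
move=> ba ca cb acm m0.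
(* For every l <= n, at least c / 2 positions start a factor x^l. *)
set n := (c %/ (2 * m)).+1.
have cn : c <= 2 * m * n by rewrite mulnC ltnW // ltn_ceil // muln_gt0.
have nm : (n.-1 * m) * 2 <= c by rewrite /= -mulnA [m * 2]mulnC leq_trunc_div.
have runs u l : size u = size a -> c <= count_mem x u -> 0 < l <= n ->
    l <= size u -> uphalf c <= count_mem (nseq l x) (factors l u).
  move=> ua cu ln lu; have := count_constant_factors_ge x lu.
  have := count_predC (pred1 x) u; rewrite ua; set spoiled := count (predC _) u.
  move=> count_u; have spoiled_m : spoiled <= m by lia.
  have : l.-1 * spoiled <= n.-1 * m by apply: leq_mul => //; lia.
  by case: l ln {lu} => // l _ /=; rewrite mulSn; lia.
have na : n <= size a.
  apply: leq_trans (leq_trans ca (count_size _ _)).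
  have : c %/ (2 * m) <= c %/ 2 by apply: leq_div2l => //; lia.
  by rewrite /n; lia.
have : n * uphalf c <= size (common_factors a b).
  apply: (@size_common_factors_ge a b x); rewrite ?ba // => l ln.
  have la : l <= size a by case/andP: ln => _ /leq_trans; apply.
  by split; apply: runs; rewrite ?ba.
have c_half : c <= 2 * uphalf c by lia.
by have := leq_mul cn c_half; rewrite mulnACA; nia.
Qed.

End Overlaps.

(** * Necklaces and their distances *)

Section Necklaces.
Variables (q l : nat).
Hypothesis l_gt0 : 0 < l.
Implicit Types u v w : l.-tuple 'I_q.

Lemma in_necklace_of v w : (v \in necklace_of w) = (tval v \in rotations w).
Proof.
rewrite inE; apply/existsP/mapP => -[i].
  move=> /eqP ->; apply/mapP/rot_in_rotations; by rewrite size_tuple.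
rewrite mem_iota size_tuple => /andP[_ il] ->.
by exists (Ordinal (ltnW il : i < l.+1)).
Qed.

Lemma necklace_of_eq v w :
  (necklace_of v == necklace_of w) = (tval v \in rotations w).
Proof.
apply/eqP/idP => [E|vw].
  by rewrite -in_necklace_of -E in_necklace_of rotations_refl ?size_tuple.
apply/setP => u; rewrite !in_necklace_of; apply/idP/idP => [uv|uw].
  exact: rotations_trans vw.
exact/(rotations_trans uw)/rotations_sym.
Qed.

Lemma representative_rotations w :
  representative (necklace_of w) \in rotations w.
Proof.
rewrite /representative; case: pickP => [v|/(_ w)].
  by rewrite in_necklace_of.
by rewrite in_necklace_of rotations_refl ?size_tuple.
Qed.

Lemma perm_representative w : perm_eq (representative (necklace_of w)) w.
Proof. exact/rotations_perm/representative_rotations. Qed.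

Lemma size_representative w : size (representative (necklace_of w)) = l.
Proof. by rewrite (perm_size (perm_representative w)) size_tuple. Qed.

Lemma card_centres k (ws : k.-tuple (l.-tuple 'I_q)) :
  rotation_free (map val ws) -> #|centres ws| = k.
Proof.
rewrite /rotation_free pairwise_map => ws_free.
have centresE : centres ws =i map (@necklace_of q l) ws.
  by move=> alpha; apply/imsetP/mapP => -[w wW ->]; exists w.
rewrite (eq_card centresE) -[RHS](size_tuple ws) -(size_map (@necklace_of q l)).
apply/card_uniqP; rewrite uniq_pairwise pairwise_map.
by apply: sub_pairwise ws_free => u v /=; rewrite necklace_of_eq.
Qed.

Section Distances.
Variable R : realType.
Local Notation common u v := (common_factors (representative (necklace_of u))
                                             (representative (necklace_of v))).
Local Notation dist u v := (overlap_distance R (necklace_of u) (necklace_of v)).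

Lemma overlap_coefficientE u v :
  overlap_coefficient R (necklace_of u) (necklace_of v) =
  ((size (common u v))%:R / (l * l)%:R)%R.
Proof.
rewrite /overlap_coefficient /lcmn gcdnn mulnK // divnn l_gt0 /wpow /= !cats0.
by rewrite !size_labelled_factors !size_representative minnn.
Qed.

Lemma overlap_distance_ge u v n : 0 < n <= l ->
  factor_disjoint n u v -> ((l%:R / n%:R)%:E <= dist u v)%E.
Proof.
move=> nl uv; have /andP[n0 n_le] := nl.
have common_le : size (common u v) <= n.-1 * l.
  rewrite -[X in _ * X](size_representative u) size_common_factors_le //.
    by rewrite size_representative.
  by rewrite (factor_disjoint_rotations _ (representative_rotations u)
    (representative_rotations v)).
have lR : (0 < l%:R :> R)%R by rewrite ltr0n.
have nR : (0 < n%:R :> R)%R by rewrite ltr0n.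
have := overlap_coefficientE u v; rewrite /overlap_distance.
set c := overlap_coefficient _ _ _ => cE.
have c_lt : (c < n%:R / l%:R)%R.
  rewrite cE natrM invfM mulrA ltr_pM2r ?invr_gt0 // ltr_pdivrMr //.
  rewrite -natrM ltr_nat (leq_ltn_trans common_le) // ltn_pmul2r //.
  by rewrite prednK.
have c_lt1 : (c < 1)%R.
  by apply: lt_le_trans c_lt _; rewrite ler_pdivrMr // mul1r ler_nat.
case: eqVneq => [_|c0]; first exact: leey.
have c_gt0 : (0 < c)%R by rewrite lt_neqAle eq_sym c0 cE divr_ge0.
by rewrite lt_eqF // lee_fin -invf_div lef_pV2 ?posrE ?ltW // divr_gt0.
Qed.

Lemma overlap_distance_ge1 u v : necklace_of u != necklace_of v ->
  (1%:E <= dist u v)%E.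
Proof.
move=> uv; have lR : (l%:R != 0 :> R)%R by rewrite pnatr_eq0 -lt0n.
rewrite -(divff lR); apply: overlap_distance_ge; rewrite ?l_gt0 ?leqnn //.
have full w : factors l w = rotations w.
  rewrite -[RHS]map_id; apply/eq_in_map => r rw.
  by rewrite take_oversize // (perm_size (rotations_perm rw)) size_tuple.
rewrite /factor_disjoint !full; apply: contra uv => /hasP[r rv ru].
rewrite necklace_of_eq; exact: rotations_trans (rotations_sym ru) rv.
Qed.

Lemma overlap_distance_ge0 u v : (0%:E <= dist u v)%E.
Proof.
rewrite /overlap_distance overlap_coefficientE.
case: ifP => _; first exact: leey.
by case: ifP => _ //; rewrite lee_fin invr_ge0 divr_ge0.
Qed.

Lemma overlap_distance_refl u : dist u u = 0%:E.
Proof.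
have lR : ((l * l)%:R != 0 :> R)%R by rewrite pnatr_eq0 -lt0n muln_gt0 l_gt0.
rewrite /overlap_distance overlap_coefficientE /common_factors msetIid.
by rewrite size_labelled_factors size_representative divff // oner_eq0 eqxx.
Qed.

Lemma overlap_distance_le u v x c m K : 0 < c -> 0 < m ->
  c <= count_mem x u -> c <= count_mem x v -> l <= c + m -> l <= K * c ->
  (dist u v <= (4 * m * K ^ 2)%:R%:E)%E.
Proof.
move=> c0 m0 cu cv l_cm l_Kc.
have runs : c * c <= 4 * m * size (common u v).
  apply: (@common_runs_ge _ _ _ x); rewrite ?size_representative //.
    by rewrite (permP (perm_representative u)).
  by rewrite (permP (perm_representative v)).
rewrite /overlap_distance overlap_coefficientE.
have common_gt0 : 0 < size (common u v).
  by move: runs; case: (size _) => //; rewrite muln0; nia.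
have ll0 : (0 < (l * l)%:R :> R)%R by rewrite ltr0n muln_gt0 l_gt0.
have cR : (0 < (size (common u v))%:R :> R)%R by rewrite ltr0n.
rewrite gt_eqF ?divr_gt0 //; case: eqVneq => _; first by rewrite lee_fin.
rewrite lee_fin invf_div ler_pdivrMr // -natrM ler_nat.
by have := leq_mul l_Kc l_Kc; nia.
Qed.

End Distances.

End Necklaces.

(** * The k-centre problem on a Parikh language *)

Lemma planted_window_le p n l (t := p %/ n) : 0 < n <= p -> p <= l ->
  p.+1 * (2 * n + (l %/ t).+1) <= 16 * n * l.
Proof.
move=> /andP[n0 np] pl; have t0 : 0 < t by rewrite divn_gt0.
have tn : t * n <= p := leq_trunc_div _ _.
have p_le : p.+1 <= 2 * n * t by have := ltn_ceil p n0; rewrite -/t; nia.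
have tG : t * (l %/ t).+1 <= l + t.
  by rewrite mulnSr leq_add2r mulnC leq_trunc_div.
have window_le : t * (2 * n + (l %/ t).+1) <= 4 * l by rewrite mulnDr; nia.
apply: (@leq_trans (2 * n * t * (2 * n + (l %/ t).+1))).
  by rewrite leq_mul2r p_le orbT.
by rewrite -mulnA; have := leq_mul (leqnn (2 * n)) window_le; lia.
Qed.

Section CentreProblem.
Variables (R : realType) (q : nat) (P : q.-tuple nat).
Local Notation l := (sumn P).
Local Notation L := (parikh_language P).
Hypothesis l_gt0 : 0 < l.
Implicit Types S : {set {set l.-tuple 'I_q}}.

Lemma parikh_languageP alpha :
  reflect (exists2 w : l.-tuple 'I_q, has_parikh P w & alpha = necklace_of w)
    (alpha \in L).
Proof.
by apply: (iffP imsetP) => -[w]; rewrite ?inE => wP ->; exists w; rewrite ?inE.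
Qed.

Lemma exists_planted_word (x y : 'I_q) n (ws : seq (seq 'I_q))
    (t := tnth P y %/ n) :
  x != y -> tnth P y <= tnth P x -> 0 < n <= tnth P y -> size ws < 2 ^ n ->
  exists B cs, [/\ size B = n, B \notin ws, cs != [::],
    all (fun w => size w <= (l %/ t).+1) cs & has_parikh P (planted B cs)].
Proof.
move=> xy yx /andP[n0 nl] ws_lt.
have [B [sB Bxy Bws]] := exists_avoiding_word xy ws_lt.
have tB i : t * count_mem i B <= tnth P i.
  have [iB|/count_memPn ->] := boolP (i \in B); last by rewrite muln0.
  have : t * count_mem i B <= tnth P y.
    apply: leq_trans (leq_trunc_div _ n).
    by rewrite leq_mul2l -sB count_size orbT.
  by move: (Bxy _ iB); rewrite !inE => /orP[] /eqP -> // /leq_trans; apply.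
pose remainder := [tuple tnth P i - t * count_mem i B | i < q].
have [w wP] : exists w, has_parikh remainder w.
  by eexists; apply: has_parikh_decreasing_word.
have t0 : 0 < t by rewrite divn_gt0.
have [|cs [cs_w cs_t csG]] := @exists_chunks _ (l %/ t).+1 t w.
  rewrite (size_has_parikh wP) (@leq_trans l) //; last first.
    by rewrite mulnC ltnW // ltn_ceil.
  by rewrite !sumn_tnth; apply: leq_sum => j _; rewrite tnth_mktuple leq_subr.
exists B, cs; split=> //; first by rewrite -size_eq0 cs_t -lt0n.
apply/has_parikhP => i; rewrite count_planted cs_t cs_w.
by rewrite (has_parikhP _ _ wP) tnth_mktuple subnKC.
Qed.

Lemma exists_far_planted_necklace S (x y : 'I_q) n (t := tnth P y %/ n) :
  S \subset L -> x != y -> tnth P y <= tnth P x -> 0 < n <= tnth P y ->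
  #|S| * l < 2 ^ n -> 2 * n + (l %/ t).+1 <= l ->
  exists2 v, v \in L &
  {in S, forall s,
    ((l%:R / (2 * n + (l %/ t).+1)%:R)%:E <= overlap_distance R s v)%E}.
Proof.
move=> SL xy yx n_le S_lt window_le.
pose ws := [seq cyclic_factor (representative s) n i
  | s <- enum S, i <- iota 0 l].
have [|B [cs [sB Bws cs0 csG vP]]] := exists_planted_word (ws := ws) xy yx n_le.
  by rewrite size_allpairs size_iota -cardE.
have sv : size (planted B cs) == l by rewrite (size_has_parikh vP).
pose v := Tuple sv.
exists (necklace_of v); first by apply/parikh_languageP; exists v.
move=> s sS; have [u _ sE] := parikh_languageP _ (subsetP SL _ sS).
have Bu : B \notin factors (size B) u.
  have uR := representative_rotations l_gt0 u.
  apply: contra Bws; rewrite -(factors_rotations _ uR) -sE sB factorsE.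
  case/mapP=> i; rewrite {1}sE size_representative // => il ->.
  by apply/allpairsP; exists (s, i); rewrite mem_enum.
rewrite sE; apply: overlap_distance_ge => //; first by rewrite window_le addnS.
rewrite factor_disjoint_sym -sB; apply: (planted_factor_disjoint cs0 csG _ Bu).
by rewrite sB (eqP sv).
Qed.

Lemma exists_unseen_necklace S : S \subset L -> #|S| < #|L| ->
  exists2 v, v \in L & {in S, forall s, (1%:E <= overlap_distance R s v)%E}.
Proof.
move=> SL S_lt; have /subsetPn[v vL vS] : ~~ (L \subset S).
  by apply: contraL S_lt => /subset_leq_card; rewrite -leqNgt.
exists v => // s sS; have sv : s != v by apply: contraNneq vS => <-.
have [u _ sE] := parikh_languageP _ (subsetP SL _ sS).
have [w _ vE] := parikh_languageP _ vL.
by move: sv; rewrite sE vE; apply: overlap_distance_ge1.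
Qed.

Lemma exists_far_necklace S (x y : 'I_q) (n := (trunc_log 2 (#|S| * l)).+1) :
  S \subset L -> #|S| < #|L| -> x != y -> tnth P y <= tnth P x ->
  exists2 v, v \in L & {in S, forall s,
    (((tnth P y).+1%:R / (16 * n)%:R)%:E <= overlap_distance R s v)%E}.
Proof.
move=> SL SltL xy yx; have n16 : (0 < (16 * n)%:R :> R)%R by rewrite ltr0n.
have [pn|np] := leqP (tnth P y).+1 (16 * n).
  have [v vL vS] := exists_unseen_necklace SL SltL; exists v => // s /vS.
  by apply: le_trans; rewrite lee_fin ler_pdivrMr // mul1r ler_nat.
have n_le : 0 < n <= tnth P y by rewrite /=; lia.
have window_le := planted_window_le n_le (parikh_le P y).
have [||v vL vS] := exists_far_planted_necklace SL xy yx n_le.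
- exact: trunc_log_ltn.
- have := leq_trans window_le (leq_mul (ltnW np) (leqnn l)).
  by rewrite leq_pmul2l.
exists v => // s /vS; apply: le_trans; rewrite lee_fin ler_pdivrMr // mulrAC.
rewrite ler_pdivlMr ?ltr0n ?addnS // -!natrM ler_nat.
by rewrite [l * _]mulnC -addnS.
Qed.

Lemma kcentre_optimum_ge k (x y : 'I_q) (n := (trunc_log 2 (k * l)).+1) :
  k < #|L| -> x != y -> tnth P y <= tnth P x ->
  (((tnth P y).+1%:R / (16 * n)%:R)%:E <= kcentre_optimum R L k)%E.
Proof.
move=> kL xy yx; apply: le_bigmin => [|S /andP[SL /eqP Sk]]; first exact: leey.
have [|v vL vS] := exists_far_necklace SL _ xy yx; first by rewrite Sk.
rewrite /centre_value; apply: bigmax_sup vL _.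
by apply: le_bigmin => [|s sS]; [exact: leey | rewrite /n -Sk; exact: vS].
Qed.

Lemma kcentre_optimum_ge0 k : 0 < #|L| -> (0%:E <= kcentre_optimum R L k)%E.
Proof.
case/card_gt0P => v vL; apply: le_bigmin => [|S /andP[SL _]]; first exact: leey.
apply: bigmax_sup (vL) _; apply: le_bigmin => [|s sS]; first exact: leey.
have [u _ ->] := parikh_languageP _ (subsetP SL _ sS).
by have [w _ ->] := parikh_languageP _ vL; apply: overlap_distance_ge0.
Qed.

Lemma card_parikh_language_le (O : seq (seq 'I_q)) :
  (forall u, has_parikh P u -> u \in rotations_of O) -> #|L| <= size O.
Proof.
move=> coverO; pose necklace (o : seq 'I_q) :=
  if insub o is Some w then @necklace_of q l w else finset.set0.
rewrite -(size_map necklace O); apply: leq_trans (card_size _).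
apply/subset_leq_card/subsetP => _ /parikh_languageP[w wP ->].
have [o oO wo] := rotations_ofP _ _ (coverO _ wP); apply/mapP; exists o => //.
have so : size o == l by rewrite -(perm_size (rotations_perm wo)) size_tuple.
by rewrite /necklace insubT /=; apply/eqP; rewrite necklace_of_eq.
Qed.

Lemma centres_subset k (ws : k.-tuple (l.-tuple 'I_q)) :
  {in ws, forall w : l.-tuple 'I_q, has_parikh P w} -> centres ws \subset L.
Proof.
move=> wsP; apply/subsetP => _ /imsetP[w /wsP wP ->].
by apply/parikh_languageP; exists w.
Qed.

Lemma centre_value_language_le0 : (centre_value R L L <= 0)%E.
Proof.
apply: bigmax_le => [|v vL]; first exact: leNye.
apply: bigmin_inf (vL) _; have [w _ ->] := parikh_languageP _ vL.
by rewrite overlap_distance_refl.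
Qed.

Lemma centre_value_le S (x : 'I_q) m :
  S \subset L -> 0 < #|S| -> l <= q * tnth P x -> l <= tnth P x + m -> 0 < m ->
  (centre_value R L S <= (4 * m * q ^ 2)%:R%:E)%E.
Proof.
move=> SL /card_gt0P[s sS] lqp lpm m0.
have px : 0 < tnth P x by case: (tnth P x) lqp => //; rewrite muln0; lia.
apply: bigmax_le => [|v vL]; first exact: leNye.
apply: bigmin_inf (sS) _.
have [u /has_parikhP uP ->] := parikh_languageP _ (subsetP SL _ sS).
have [w /has_parikhP wP ->] := parikh_languageP _ vL.
by apply: (@overlap_distance_le _ _ l_gt0 _ _ _ x (tnth P x)); rewrite ?uP ?wP.
Qed.

End CentreProblem.

(** * The approximation rate *)

Section Rate.
Variable R : realType.
Local Open Scope ring_scope.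

Lemma ln_ge_1BV (x : R) : 0 < x -> 1 - x^-1 <= ln x.
Proof.
move=> x0; have := @le_ln1Dx R (x^-1 - 1).
rewrite [1 + _]addrC subrK lnV ?posrE // => ln_le.
have xV0 : 0 < x^-1 by rewrite invr_gt0.
have /ln_le : -1 < x^-1 - 1 by lra.
lra.
Qed.

Lemma ln_nat_ge_half n : (1 < n)%N -> 2^-1 <= ln (n%:R : R).
Proof.
move=> n1; apply: le_trans (ln_ge_1BV _); last by rewrite ltr0n ltnW.
have : (n%:R : R)^-1 <= 2^-1 by rewrite lef_pV2 ?posrE ?ltr0n ?ler_nat // ltnW.
lra.
Qed.

Lemma trunc_log_ln b n : (1 < b)%N -> (0 < n)%N ->
  (trunc_log b n)%:R * ln (b%:R : R) <= ln (n%:R : R).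
Proof.
move=> b1 n0; have b0 : (0 < b)%N := ltnW b1.
rewrite mulrC mulr_natr -lnXn ?ltr0n // -natrX.
by rewrite ler_ln ?posrE ?ltr0n ?expn_gt0 ?b0 // ler_nat trunc_logP.
Qed.

(* exp dominates its tangent line at 0, here at a ln x / n. *)
Lemma ln_exprn_le_powR (a x : R) n : 0 < a -> a <= n%:R -> 1 <= x ->
  (1 + ln x) ^+ n <= (n%:R / a) ^+ n * x `^ a.
Proof.
move=> a0 an x1; have n0 : 0 < n%:R :> R by apply: lt_le_trans an.
have y0 : 0 <= ln x by rewrite ln_ge0.
have -> : x `^ a = expR (a * ln x / n%:R) ^+ n.
  rewrite -expRM_natl /powR gt_eqF ?(lt_le_trans _ x1) //; congr expR.
  by rewrite [RHS]mulrC divfK ?gt_eqF.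
rewrite -exprMn; apply: lerXn2r; rewrite ?nnegrE.
- by rewrite addr_ge0.
- by rewrite mulr_ge0 ?expR_ge0 // divr_ge0 // ltW.
apply: le_trans (ler_wpM2l _ (expR_ge1Dx _)); last by rewrite divr_ge0 // ltW.
have -> : n%:R / a * (1 + a * ln x / n%:R) = n%:R / a + ln x.
  by field; rewrite !gt_eqF.
by rewrite lerD2r ler_pdivlMr // mul1r.
Qed.

Lemma logb_mulr_base (b x : R) : 1 < b -> 0 < x ->
  logb b (x * b) = 1 + logb b x.
Proof.
move=> b1 x0; have b0 : 0 < b by apply: lt_trans b1.
by rewrite /logb lnM ?posrE // mulrDl divff 1?addrC // gt_eqF ?ln_gt0.
Qed.

Lemma logb_nat_le (b n : nat) : (1 < b)%N -> (0 < n)%N ->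
  0 <= logb b%:R (n%:R : R) <= 2 * ln n%:R.
Proof.
move=> b1 n0; have b_half := ln_nat_ge_half b1.
have lnn : 0 <= ln (n%:R : R) by rewrite ln_ge0 // ler1n.
rewrite /logb divr_ge0 //; last lra.
by rewrite ler_pdivrMr; [nra | lra].
Qed.

Lemma trunc_log_le_approx_rate q l k : (1 < q)%N -> (0 < l)%N -> (0 < k)%N ->
  (trunc_log 2 (k * l)).+1%:R <= 27 * q%:R ^+ 3 * approx_rate R q l k.
Proof.
move=> q1 l0 k0; have kl0 : (0 < k * l)%N by rewrite muln_gt0 k0.
have x1 : 1 <= (k * l)%:R :> R by rewrite ler1n.
set y : R := 1 + ln (k * l)%:R; have y1 : 1 <= y by rewrite lerDl ln_ge0.
have trunc_le : (trunc_log 2 (k * l)).+1%:R <= 2 * y.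
  have := trunc_log_ln (isT : (1 < 2)%N) kl0.
  have ln2_half := ln_nat_ge_half (isT : (1 < 2)%N).
  have := ler_wpM2l (ler0n R (trunc_log 2 (k * l))) ln2_half.
  by rewrite -[(trunc_log _ _).+1%:R]natr1 /y; lra.
have q1R : 1 < q%:R :> R by rewrite ltr1n.
rewrite /approx_rate (natrM _ k q) (logb_mulr_base q1R) ?ltr0n //.
have /andP[lk0 lk_le] := logb_nat_le q1 k0.
have lk_y : ln (k%:R : R) <= y - 1.
  by rewrite /y addrC addKr ler_ln ?posrE ?ltr0n // ler_nat leq_pmulr.
set b := 1 + logb _ _; have b_le : b <= 2 * y by rewrite /b; lra.
have b1 : 1 <= b by rewrite /b; lra.
rewrite mulrA ler_pdivlMr ?exprn_gt0 ?(lt_le_trans _ b1) //.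
have q0 : 0 < q%:R :> R by rewrite ltr0n ltnW.
have pow_le : y ^+ 3 <= (3 / (2 / q%:R)) ^+ 3 * (k * l)%:R `^ (2 / q%:R).
  apply: ln_exprn_le_powR x1; first by rewrite divr_gt0.
  by rewrite ler_pdivrMr //; lra.
apply: (@le_trans _ _ (2 * y * (2 * y) ^+ 2)).
  apply: ler_pM => //; first by rewrite exprn_ge0 // (le_trans _ b1).
  by apply: lerXn2r => //; rewrite nnegrE; lra.
rewrite (_ : 2 * y * _ = 8 * y ^+ 3); last by ring.
apply: le_trans (ler_wpM2l _ pow_le) _ => //.
rewrite mulrA ler_wpM2r ?powR_ge0 //.
by rewrite (_ : 8 * _ = 27 * q%:R ^+ 3) //; field; rewrite gt_eqF.
Qed.

End Rate.

Section Approximation.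
Variables (R : realType) (q : nat) (P : q.-tuple nat) (k : nat).
Local Notation l := (sumn P).
Local Notation L := (parikh_language P).
Hypotheses (q_gt1 : 1 < q) (l_gt0 : 0 < l) (k_gt0 : 0 < k).

(* The constant is 64 q^3 * 27 q^3: 64 q^3 n bounds the ratio of
   [centre_value_le] to [kcentre_optimum_ge], and 27 q^3 comes from
   [trunc_log_le_approx_rate]. *)
Lemma centre_value_approx (S : {set {set l.-tuple 'I_q}}) :
  S \subset L -> #|S| = k ->
  (centre_value R L S <=
   ((12 * q%:R ^+ 2) ^+ 3 * approx_rate R q l k)%:E * kcentre_optimum R L k)%E.
Proof.
move=> SL Sk; set C := (_ ^+ 3)%R; set r := approx_rate _ _ _ _.
have n_le := trunc_log_le_approx_rate R q_gt1 l_gt0 k_gt0; rewrite -/r in n_le.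
set n := (trunc_log _ _).+1 in n_le.
have Cn_le : (64 * q%:R ^+ 3 * n%:R <= C * r)%R.
  apply: le_trans (ler_wpM2l _ n_le) _; first by rewrite mulr_ge0 ?exprn_ge0.
  by rewrite mulrA (_ : (64 * _ * _)%R = C) // /C; ring.
have Cr0 : (0 <= C * r)%R by apply: le_trans Cn_le; rewrite mulr_ge0 ?mulr_ge0.
have [kL|kL] := eqVneq k #|L|.
  have -> : S = L by apply/eqP; rewrite eqEcard SL Sk kL /=.
  apply: le_trans (centre_value_language_le0 R l_gt0) _.
  by rewrite mule_ge0 ?lee_fin // kcentre_optimum_ge0 // -kL.
have {}kL : k < #|L| by rewrite ltn_neqAle kL -Sk subset_leq_card.
have [x [y [xy yx l_qx l_xy]]] := exists_two_most_frequent P q_gt1.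
apply: (@le_trans _ _ (4 * (q * (tnth P y).+1) * q ^ 2)%:R%:E).
  apply: (centre_value_le R l_gt0 SL _ l_qx); rewrite ?Sk //.
    by apply: leq_trans l_xy _; rewrite leq_add2l leq_mul2l leqnSn orbT.
  by rewrite muln_gt0 ltnW.
have optimum_ge := kcentre_optimum_ge R l_gt0 kL xy yx.
apply: le_trans (lee_wpmul2l _ optimum_ge); last by rewrite lee_fin.
rewrite -EFinM lee_fin -/n.
apply: le_trans (ler_wpM2r _ Cn_le); last by rewrite divr_ge0.
rewrite (_ : (64 * _ * _ * _)%R = (4 * (q * (tnth P y).+1) * q ^ 2)%:R)%R //.
by rewrite !natrM; field; rewrite pnatr_eq0.
Qed.

Lemma search_prog_finds_centres : k <= #|L| ->
  exists (ws : k.-tuple (l.-tuple 'I_q)) (t : nat),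
    [/\ runs search_prog (enc_instance P k) (enc_solution ws) t,
        t <= 500 * (q + l + k) ^ 6, centres ws \subset L & #|centres ws| = k].
Proof.
move=> kL; have [O coverO|s [t [run [O [sO szO OP dO t_le]]]]] :=
    @halts_search_prog q P k l_gt0.
  exact/(leq_trans kL)/card_parikh_language_le.
pose W : seq (l.-tuple 'I_q) := pmap insub O.
have WE : map val W = O.
  rewrite pmap_filter; last exact: insubK.
  apply/all_filterP/allP => o oO.
  by rewrite isSome_insub (size_has_parikh (OP o oO)).
have sW : size W == k by rewrite -szO -WE size_map.
exists (Tuple sW), t; split=> //.
- by exists s; rewrite // /enc_solution sO /= -WE -map_comp.
- by apply: centres_subset => w wW; rewrite OP // -WE map_f.
- by apply: card_centres; rewrite //= WE.
Qed.

End Approximation.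

Theorem theorem7 (R : realType) :
  exists (p : cmd) (c d : nat),
  forall q : nat, 2 <= q ->
  exists C : R, (0 < C)%R /\
  forall (P : q.-tuple nat) (k : nat),
    0 < sumn P -> 1 <= k -> k <= #|parikh_language P| ->
  exists (ws : k.-tuple ((sumn P).-tuple 'I_q)) (t : nat),
    [/\ runs p (enc_instance P k) (enc_solution ws) t,
        t <= c * (q + sumn P + k) ^ d,
        centres ws \subset parikh_language P,
        #|centres ws| = k
      & (centre_value R (parikh_language P) (centres ws)
         <= (C * approx_rate R q (sumn P) k)%:E
            * kcentre_optimum R (parikh_language P) k)%E].
Proof.
exists search_prog, 500, 6 => q q2; exists ((12 * q%:R ^+ 2) ^+ 3)%R.
split=> [|P k l0 k0 kL].
  by rewrite exprn_gt0 ?mulr_gt0 ?exprn_gt0 ?ltr0n // ltnW.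
have [ws [t [run t_le wsL ws_card]]] := search_prog_finds_centres l0 kL.
by exists ws, t; split=> //; apply: centre_value_approx.
Qed.
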